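(* Let $d\ge 2$ be a fixed integer. In the random recursive $d$-DAG $G_n$, the function $g(n)=n^{\frac{d-1}{d+1}}$ is a threshold for the set $[n]\setminus D_n$ of non-descendants of $n$; that is, as $n\to\infty$, $$\mathbb{P}\big(([n]\setminus D_n)\cap[m]\ne\emptyset\big)\to\begin{cases}0 & \text{if } m=m(n)=o\big(n^{\frac{d-1}{d+1}}\big),\\ 1 & \text{if } m=m(n)=\omega\big(n^{\frac{d-1}{d+1}}\big).\end{cases}$$
   Context: Write $[n]=\{1,\dots,n\}$. Random recursive $d$-DAG: $G_n$ is the directed acyclic (multi)graph on $[n]$ in which each vertex $j\in\{2,\dots,n\}$ has exactly $d$ outgoing arrows, whose targets are chosen independently and uniformly at random from $[j-1]$ (with replacement), independently of the choices at all other vertices. Write $i\stackrel{*}{\longrightarrow} j$ if $j$ can be reached from $i$ by a directed path (possibly of length $0$). The set of descendants of $n$ is $D_n=\{j\in[n]: n\stackrel{*}{\longrightarrow} j\}$. A function $g(n)$ is a threshold for a (random) set $S$ of vertices in $G_n$ if $\mathbb{P}(S\cap[m]\neq\emptyset)\to 0$ whenever $m=m(n)=o(g(n))$ and $\mathbb{P}(S\cap[m]\neq\emptyset)\to 1$ whenever $m=m(n)=\omega(g(n))$ (i.e. $m(n)/g(n)\to\infty$). *)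

(* Defs.v *)
From HB Require Import structures.
From mathcomp Require Import all_boot all_order all_algebra.
From mathcomp Require Import all_classical all_reals all_analysis.

Set Implicit Arguments.
Unset Strict Implicit.
Unset Printing Implicit Defensive.

Import Order.TTheory GRing.Theory Num.Theory.
Import numFieldNormedType.Exports.

Local Open Scope ring_scope.

(* The vertex set [n] = {1, ..., n} is encoded by 'I_n, with i : 'I_n standing
   for the vertex i + 1.  An outcome of the random recursive d-DAG records, for
   each i < n - 1, the d targets of the vertex i + 2 (number i.+1 in 'I_n);
   these lie in [i + 1], encoded by 'I_i.+1.  The d choices are labelled by
   'I_d, so that repeated targets (multiple arrows) are allowed. *)
Definition dag (d n : nat) :=
  {dffun forall i : 'I_n.-1, {ffun 'I_d -> 'I_i.+1}}.

(* All choices are independent and uniform: the k-th target of the vertex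
   i + 2 takes each value in [i + 1] with probability 1 / (i + 1). *)
Definition dag_law (R : realType) (d n : nat) (G : dag d n) : R :=
  \prod_(i < n.-1) \prod_(k < d) (i.+1%:R)^-1.

Definition dag_prob (R : realType) (d n : nat) (E : pred (dag d n)) : R :=
  \sum_(G : dag d n | E G) dag_law R G.

Definition arrow (d n : nat) (G : dag d n) : rel 'I_n :=
  fun u v => [exists i : 'I_n.-1, [exists k : 'I_d,
    (nat_of_ord u == i.+1) && (nat_of_ord v == G i k)]].

(* The vertex n is the r : 'I_n with r.+1 = n; it exists whenever 0 < n. *)
Definition descendants (d n : nat) (G : dag d n) : {set 'I_n} :=
  [set j : 'I_n | [exists r : 'I_n, (r.+1 == n) && connect (arrow G) r j]].

(* S meets [m] = {1, ..., m}. *)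
Definition meets_initial (n m : nat) (S : {set 'I_n}) : bool :=
  S :&: [set i : 'I_n | (i < m)%N] != finset.set0.

Local Open Scope classical_set_scope.

Definition threshold (R : realType) (d : nat) (g : nat -> R)
    (S : forall n : nat, dag d n -> {set 'I_n}) : Prop :=
  forall m : nat -> nat,
    let p n : R :=
      dag_prob R [pred G : dag d n | meets_initial (m n) (S n G)] in
    ((fun n => (m n)%:R : R) =o_\oo g -> p n @[n --> \oo] --> (0 : R)) /\
    ((m n)%:R / g n @[n --> \oo] --> +oo -> p n @[n --> \oo] --> (1 : R)).

(* Main.v *)
Require Import Defs.
From HB Require Import structures.
From mathcomp Require Import all_boot all_order all_algebra.
From mathcomp Require Import all_classical all_reals all_analysis.
From mathcomp Require Import ring lra zify.

Set Implicit Arguments.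
Unset Strict Implicit.
Unset Printing Implicit Defensive.

Import Order.TTheory GRing.Theory Num.Theory.
Import numFieldNormedType.Exports.

Local Open Scope ring_scope.

(* Reveal the vertices from n downwards, and let Y_k be the number of arrows
   from descendants of n above k into [k]; given the past, their ends are
   independent and uniform on [k].  Hence, for every real s,
     E s^Y_(k-1) = s^d E(s + (1-s)/k)^Y_k + (1-s^d) E(s(1-1/k))^Y_k.
   With s = c/(k-1) this telescopes, so that sum_(0<c<k) E(c/k)^Y_k / c^d
   does not decrease when k grows up to n-1, where Y_k = d; as 1-1/k is the
   probability that an arrow misses a given vertex, a vertex of [m] is a
   non-descendant with probability at most m^d/(n-1)^(d-1), and the union bound
   gives the first half.  With s = k/(k-1) the second expectation is 1, which
   yields
     E(1+1/m)^Y_m = 1 + (n^d - (n-1)^d) / m^d.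
   Given Y_m, the number of vertices of [m] missed by these Y_m arrows and by
   all arrows inside [m] is a sum of negatively correlated indicators, with mean
   of order m(1-1/m)^Y_m.  By Chebyshev it vanishes with probability
   O((1+1/m)^Y_m / m), which averages to O(1/m + n^(d-1)/m^(d+1)). *)

(** * Expectations over independent uniform coordinates *)

Section ProductMean.
Context {R : realFieldType} {V J : finType}.
Implicit Types (Q : V -> pred J) (F : {ffun V -> J} -> R).

Definition mean Q F : R :=
  (\prod_e #|Q e|%:R)^-1 * \sum_(f in family Q) F f.

Lemma mean_prod Q (g : V -> J -> R) :
  mean Q (fun f => \prod_e g e (f e)) =
  \prod_e (#|Q e|%:R^-1 * \sum_(j | Q e j) g e j).
Proof. by rewrite /mean -bigA_distr_big_dep big_split /= prodfV. Qed.

Lemma eq_mean Q F F' :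
  (forall f, f \in family Q -> F f = F' f) -> mean Q F = mean Q F'.
Proof. by move=> eqF; congr (_ * _); apply: eq_bigr. Qed.

Lemma le_mean Q F F' :
  (forall f, f \in family Q -> F f <= F' f) -> mean Q F <= mean Q F'.
Proof.
move=> leF; apply: ler_wpM2l; last exact: ler_sum.
by rewrite invr_ge0 prodr_ge0.
Qed.

Lemma mean_ge0 Q F : (forall f, 0 <= F f) -> 0 <= mean Q F.
Proof.
by move=> F0; rewrite mulr_ge0 ?sumr_ge0 // invr_ge0 prodr_ge0.
Qed.

Lemma meanD Q F F' : mean Q (fun f => F f + F' f) = mean Q F + mean Q F'.
Proof. by rewrite /mean big_split mulrDr. Qed.

Lemma meanZ Q c F : mean Q (fun f => c * F f) = c * mean Q F.
Proof. by rewrite /mean -mulr_sumr mulrCA. Qed.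

Lemma mean_sum Q (I : finType) (P : pred I) (F : I -> {ffun V -> J} -> R) :
  mean Q (fun f => \sum_(i | P i) F i f) = \sum_(i | P i) mean Q (F i).
Proof. by rewrite /mean exchange_big -mulr_sumr. Qed.

Lemma mean_cst Q c : (forall e, (0 < #|Q e|)%N) -> mean Q (fun=> c) = c.
Proof.
move=> Q0; have H : \prod_(e : V) (#|Q e|%:R : R) != 0.
  by apply/prodf_neq0 => e _; rewrite pnatr_eq0 -lt0n.
rewrite /mean -[in X in _ * X](mulr1 c) -mulr_sumr mulrCA.
suff -> : \sum_(f in family Q) 1 = \prod_(e : V) (#|Q e|%:R : R).
  by rewrite mulVf ?mulr1.
transitivity (\sum_(f in family Q) \prod_(e : V) (1 : R)).
  by apply: eq_bigr => f _; rewrite big1.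
rewrite -(bigA_distr_big_dep Q (fun _ _ => 1)).
by apply: eq_bigr => e _; rewrite sumr_const.
Qed.

(** This models conditioning on which coordinates fall in L and on all values outside L: only the
    values inside L are redrawn, from t. *)
Definition resample (L : pred J) (f t : {ffun V -> J}) : {ffun V -> J} :=
  [ffun e => if L (f e) then t e else f e].

(* Exchanging the L-coordinates of f with those of t is an involution. *)
Lemma mean_resample (L : pred J) Q F :
  (forall e, (0 < #|predI (Q e) L|)%N) ->
  mean Q F = mean Q (fun f =>
    mean (fun e => predI (Q e) L) (fun t => F (resample L f t))).
Proof.
move=> QL0; pose QL e := predI (Q e) L.
(* A dummy average over t makes both sides sums over pairs (f, t), on which the exchange acts. *)
rewrite -[LHS](eq_mean (F := fun f => mean QL (fun=> F f))); last first.
  by move=> f _; rewrite mean_cst.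
rewrite /mean; congr (_ * _); rewrite -!mulr_sumr; congr (_ * _).
rewrite !pair_big_dep /=.
pose swap (p : {ffun V -> J} * {ffun V -> J}) :=
  (resample L p.1 p.2, [ffun e => if L (p.1 e) then p.1 e else p.2 e]).
rewrite (reindex_onto swap swap) /=; last first.
  case=> f t /= /andP[fQ /familyP tQ]; congr pair; apply/ffunP => e;
    move: (tQ e); rewrite !ffunE inE /= => /andP[_ tL];
    by case fL: (L (f e)); rewrite ?tL ?fL.
apply: eq_bigl => -[f t] /=; apply/andP/andP => -[].
  move=> /andP[/familyP fQ /familyP tQ] /eqP[/ffunP ef /ffunP et].
  split; apply/familyP => e; move: (fQ e) (tQ e) (ef e) (et e);
    rewrite !inE !ffunE /=; case fL: (L (f e)) => //=.
    by move=> _ /andP[].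
  move=> Qt _ _; case tL: (L (t e)) => ft; first by rewrite andbT.
  by rewrite -ft fL in tL.
move=> /familyP fQ /familyP tQ; split; last first.
  apply/eqP; congr pair; apply/ffunP => e; move: (tQ e);
    rewrite !ffunE inE /= => /andP[_ tL];
    by case fL: (L (f e)); rewrite ?tL ?fL.
apply/andP; split; apply/familyP => e; move: (fQ e) (tQ e);
  rewrite !inE !ffunE /=; case fL: (L (f e)) => //=.
  by move=> _ /andP[].
by rewrite fL andbT.
Qed.

End ProductMean.

(** * Negative correlation and Chebyshev's inequality *)

Section NegativeCorrelation.
Context {R : realFieldType} {V J : finType}.
Implicit Types (Q : V -> pred J) (S : {set V}) (t : {ffun V -> J}) (u w : J).

Definition avoids S u t : bool := [forall e in S, t e != u].

Lemma avoids_prod S u t :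
  (avoids S u t)%:R = \prod_(e in S) (t e != u)%:R :> R.
Proof.
case: (boolP (avoids S u t)) => [/forall_inP av|/forall_inPn[e eS te]].
  by rewrite big1 // => e /av ->.
by rewrite (bigD1 e) //= (negbTE te) mul0r.
Qed.

Lemma sum_neq (P : pred J) u :
  \sum_(j | P j) (j != u)%:R = #|P|%:R - (P u)%:R :> R.
Proof.
rewrite (eq_bigr (fun j => 1 - (j == u)%:R)) => [|j _]; last first.
  by case: (j == u); rewrite ?subrr ?subr0.
rewrite sumrB sumr_const; congr (_ - _).
case Pu: (P u).
  by rewrite (bigD1 u) //= eqxx big1 ?addr0 // => j /andP[_ /negbTE ->].
by rewrite big1 // => j Pj; case: eqP => // ju; rewrite -ju Pj in Pu.
Qed.

Lemma sum_neq2 (P : pred J) u w : u != w ->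
  \sum_(j | P j) (j != u)%:R * (j != w)%:R =
    #|P|%:R - (P u)%:R - (P w)%:R :> R.
Proof.
move=> uw.
rewrite (eq_bigr (fun j => (j != u)%:R + (j != w)%:R - 1)) => [|j _].
  by rewrite sumrB big_split /= !sum_neq sumr_const; ring.
have [->|_] := eqVneq j u; first by rewrite uw /=; ring.
by case: (j != w) => /=; ring.
Qed.

Lemma mean_avoids Q S u : (forall e, (0 < #|Q e|)%N) ->
  mean Q (fun t => (avoids S u t)%:R) =
  \prod_(e in S) (1 - (Q e u)%:R / #|Q e|%:R) :> R.
Proof.
move=> Q0; under eq_mean do rewrite avoids_prod big_mkcond /=.
rewrite (mean_prod _ (fun e j => if e \in S then (j != u)%:R else 1)).
rewrite [RHS]big_mkcond; apply: eq_bigr => e _.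
have Qe : #|Q e|%:R != 0 :> R by rewrite pnatr_eq0 -lt0n.
case: (e \in S); last by rewrite sumr_const mulVf.
by rewrite sum_neq mulrBr mulVf // mulrC.
Qed.

(** Independence reduces this to one coordinate: if it hits u and w with probabilities x and y, then
    1 - x - y <= (1 - x)(1 - y), the gap being xy. *)
Lemma mean_avoids2 Q S u w : (forall e, (0 < #|Q e|)%N) -> u != w ->
  mean Q (fun t => (avoids S u t && avoids S w t)%:R) <=
  mean Q (fun t => (avoids S u t)%:R) * mean Q (fun t => (avoids S w t)%:R)
  :> R.
Proof.
move=> Q0 uw; rewrite !mean_avoids // -big_split /=.
under eq_mean do rewrite -mulnb natrM !avoids_prod -big_split big_mkcond /=.
rewrite (mean_prod _
  (fun e j => if e \in S then (j != u)%:R * (j != w)%:R else 1)).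
rewrite [leRHS]big_mkcond; apply: ler_prod => e _.
have Qe : 0 < #|Q e|%:R :> R by rewrite ltr0n.
rewrite mulr_ge0 ?invr_ge0 ?sumr_ge0 //=; last first.
  by move=> j _; case: ifP => // _; rewrite mulr_ge0.
case: (e \in S); last by rewrite sumr_const mulVf // lt0r_neq0.
rewrite sum_neq2 // !mulrBr mulVf ?lt0r_neq0 // ![_^-1 * _]mulrC.
set x := _ / _; set y := _ / _; rewrite -subr_ge0.
have -> : (1 - x) * 1 - (1 - x) * y - (1 - x - y) = x * y by ring.
by rewrite mulr_ge0 // divr_ge0.
Qed.

(* Chebyshev's inequality for the number of u in B for which X u holds: its
   variance is at most its mean. *)
Lemma mean_none Q (I : finType) (B : pred I) (X : I -> {ffun V -> J} -> bool) :
  (forall e, (0 < #|Q e|)%N) ->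
  (forall u w : I, u != w -> mean Q (fun t => (X u t && X w t)%:R) <=
     mean Q (fun t => (X u t)%:R) * mean Q (fun t => (X w t)%:R) :> R) ->
  (\sum_(u : I | B u) mean Q (fun t => (X u t)%:R)) *
    mean Q (fun t => [forall u : I in B, ~~ X u t]%:R) <= 1 :> R.
Proof.
move=> Q0 negX; set mu := \sum_(u : I | B u) _.
set none := mean Q _.
have mu_ge0 : 0 <= mu by apply: sumr_ge0 => u _; apply: mean_ge0.
have [->|mu_neq0] := eqVneq mu 0; first by rewrite mul0r.
have mu_gt0 : 0 < mu by rewrite lt0r mu_neq0.
rewrite -(ler_pM2l mu_gt0) mulr1 mulrA -expr2.
pose n t : R := \sum_(u : I | B u) (X u t)%:R.
have mean_n : mean Q n = mu by rewrite /n mean_sum.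
have mean_n2 : mean Q (fun t => n t * n t) <= mu + mu ^+ 2.
  have -> : mean Q (fun t => n t * n t) = \sum_(u : I | B u) \sum_(w : I | B w)
      mean Q (fun t => (X u t && X w t)%:R).
    under [RHS]eq_bigr do rewrite -mean_sum.
    rewrite -mean_sum; apply: eq_mean => t _.
    rewrite /n mulr_suml; apply: eq_bigr => u _; rewrite mulr_sumr.
    by apply: eq_bigr => w _; rewrite -natrM mulnb.
  rewrite expr2 {2}/mu mulr_suml -big_split /=; apply: ler_sum => u Bu.
  rewrite (bigD1 u) //= lerD //.
    by apply: le_mean => t _; rewrite andbb.
  rewrite /mu mulr_sumr [leRHS](bigD1 u) //= -[leLHS]add0r lerD //.
    by rewrite mulr_ge0 // mean_ge0.
  by apply: ler_sum => w /andP[_ wu]; rewrite negX // eq_sym.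
(* The right-hand side averages (n t - mu)^2, which is mu^2 when n t = 0; it is expanded so that
   linearity applies. *)
have : mu ^+ 2 * none <=
    mean Q (fun t => n t * n t + ((- 2 * mu) * n t + mu ^+ 2)).
  rewrite -meanZ; apply: le_mean => t _.
  case: forall_inP => [none_t|_].
    rewrite (_ : n t = 0) ?mulr0 ?add0r ?mulr1 //.
    by apply: big1 => u /none_t/negbTE ->.
  rewrite mulr0 (_ : _ + _ = (n t - mu) ^+ 2) ?sqr_ge0 //; ring.
rewrite !meanD meanZ mean_cst // mean_n => /le_trans; apply.
by rewrite -lerBrDr (le_trans mean_n2) //; lra.
Qed.

End NegativeCorrelation.

(** * Arrow configurations, descendants and cuts *)

Section Configurations.
Context {R : realFieldType} {d N : nat}.
Implicit Types (f t : {ffun 'I_N * 'I_d -> 'I_N}) (e : 'I_N * 'I_d).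

(* With n = N + 1 and the vertices 0, ..., N, the configuration f is the graph
   whose e-th arrow goes from e.1 + 1 to f e; [m] is low m, and Y_m is the
   cardinality of cut m f. *)
Definition tgt e : pred 'I_N := [pred j : 'I_N | j <= e.1]%N.
Definition low m : pred 'I_N := [pred j : 'I_N | j < m]%N.
Definition low_tgt m e : pred 'I_N := predI (tgt e) (low m).

Definition cfg_arrow f : rel 'I_N.+1 := fun u v =>
  [exists e : 'I_N * 'I_d, (u == e.1.+1 :> nat) && (v == f e :> nat)].

(** [ord_max] is the vertex n. With v in nat, sources [e.1.+1] and ends [f e] are treated alike; the
    value is false for v > N. *)
Definition reach f (v : nat) : bool :=
  [exists w : 'I_N.+1, (w == v :> nat) && connect (cfg_arrow f) ord_max w].

Definition cut m f : {set 'I_N * 'I_d} :=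
  [set e : 'I_N * 'I_d | [&& (m <= e.1.+1)%N, reach f e.1.+1 & (f e < m)%N]].

Lemma card_tgt_gt0 e : (0 < #|tgt e|)%N.
Proof. by apply/card_gt0P; exists e.1; rewrite inE. Qed.

Lemma card_low m : (m <= N)%N -> #|low m| = m.
Proof.
move=> mN; rewrite -[RHS]card_ord -(card_codom (f := widen_ord mN)); last first.
  by move=> i j /(congr1 val)/= ij; apply/val_inj.
apply: eq_card => j; apply/idP/codomP => [jm|[i ->]]; last by rewrite inE /=.
by exists (Ordinal (jm : (j < m)%N)); apply/val_inj.
Qed.

Lemma low_tgt_above m e : (m <= e.1.+1)%N -> low_tgt m e =1 low m.
Proof. by move=> me j; apply: andb_idl => /leq_trans/(_ me). Qed.

Lemma low_tgt_below m e : (e.1 < m)%N -> low_tgt m e =1 tgt e.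
Proof. by move=> em j; apply: andb_idr => /leq_ltn_trans/(_ em). Qed.

Lemma card_low_tgt_gt0 m e : (0 < m)%N -> (0 < #|low_tgt m e|)%N.
Proof.
move=> m0; have N0 : (0 < N)%N by case: (e.1) => i /(leq_trans _); apply.
by apply/card_gt0P; exists (Ordinal N0); rewrite inE /=.
Qed.

(** Split a path at its last arrow. *)
Lemma reach_rec f v : (v <= N)%N ->
  reach f v = (v == N) ||
    [exists e : 'I_N * 'I_d, reach f e.1.+1 && (f e == v :> nat)].
Proof.
move=> vN; apply/existsP/orP => [[w /andP[/eqP wv /connectP[p]]]|].
  case/lastP: p => [_ /= wN|p x]; first by left; rewrite -wv wN.
  rewrite rcons_path last_rcons => /andP[px /existsP[e /andP[/eqP xe /eqP xv]]].
  move=> ewx; right; apply/existsP; exists e; rewrite -wv ewx xv eqxx andbT.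
  apply/existsP; exists (last ord_max p); rewrite xe eqxx /=.
  by apply/connectP; exists p.
case=> [/eqP->|/existsP[e /andP[/existsP[w /andP[/eqP we cw]] /eqP fe]]].
  by exists ord_max; rewrite eqxx connect0.
have lt_v : (v < N.+1)%N by [].
exists (Ordinal lt_v); rewrite eqxx; apply: connect_trans cw (connect1 _).
by apply/existsP; exists e; rewrite we eqxx; apply/eqP.
Qed.

Lemma reach_root f : reach f N.
Proof. by rewrite reach_rec // eqxx. Qed.

Lemma reach_arrow f e v : reach f e.1.+1 -> f e = v :> nat -> reach f v.
Proof.
move=> re fe; rewrite reach_rec; last by rewrite -fe ltnW.
by apply/orP; right; apply/existsP; exists e; rewrite re fe eqxx.
Qed.

Lemma tgtP f : reflect (forall e, (f e <= e.1)%N) (f \in family tgt).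
Proof. by apply: (iffP familyP) => H e; have := H e; rewrite inE. Qed.

Lemma low_tgtP m t :
  reflect (forall e, (t e <= e.1)%N /\ (t e < m)%N) (t \in family (low_tgt m)).
Proof.
apply: (iffP familyP) => H e; first by have /andP[] := H e.
by rewrite inE /=; apply/andP/H.
Qed.

Lemma resample_tgt m f t : f \in family tgt -> t \in family (low_tgt m) ->
  resample (low m) f t \in family tgt.
Proof.
move=> /tgtP ft /low_tgtP tt; apply/tgtP => e; rewrite ffunE.
by case: ifP => // _; have [] := tt e.
Qed.

Lemma resample_ltP m f t e : t \in family (low_tgt m) ->
  (resample (low m) f t e < m)%N = (f e < m)%N.
Proof.
move=> /low_tgtP/(_ e)[_ te]; rewrite ffunE /=.
by case: ifP => // fe; rewrite te.
Qed.

(** Arrows descend, so a path to v >= m uses only arrows ending at m or above, and these are not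
    redrawn. The induction goes down from N. *)
Lemma reach_resample m f t v :
  f \in family tgt -> t \in family (low_tgt m) -> (m <= v <= N)%N ->
  reach (resample (low m) f t) v = reach f v.
Proof.
move=> ft tt; have [k] := ubnP (N - v); elim: k v => // k IH v.
rewrite ltnS => Nv /andP[mv vN]; rewrite !reach_rec //; congr (_ || _).
apply: eq_existsb => e0; pose e : 'I_N * 'I_d := e0; rewrite -/e.
have [lt_e|le_e] := ltnP (f e) m.
  have ne j : (j < m)%N -> (j == v) = false.
    by move=> jm; rewrite ltn_eqF // (leq_trans jm).
  by rewrite !ne ?andbF ?resample_ltP.
rewrite ffunE ifN; last by rewrite -leqNgt.
have [fv|] := eqVneq (f e : nat) v;
  last by rewrite !andbF.
have ve : (v <= e.1)%N by rewrite -fv; move/tgtP: ft; apply.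
have eN := ltn_ord e.1.
by rewrite !andbT IH //; clear -Nv mv ve eN; lia.
Qed.

Lemma cut_resample m f t :
  f \in family tgt -> t \in family (low_tgt m) ->
  cut m (resample (low m) f t) = cut m f.
Proof.
move=> ft tt; apply/setP => e; rewrite !inE resample_ltP //.
have [me|//] := leqP m e.1.+1.
by rewrite reach_resample // me /=.
Qed.

(** Arrows from inside [m] must miss v whether or not their source is a descendant; this makes the
    condition one on a set of arrows fixed by the cut. *)
Lemma reach_above m f v : f \in family tgt -> (v < m <= N)%N ->
  (forall e, e \in cut m f -> f e <> v :> nat) ->
  (forall e, (e.1.+1 < m)%N -> f e <> v :> nat) -> ~~ reach f v.
Proof.
move=> ft /andP[vm mN] cutv lowv; rewrite reach_rec; last by lia.
rewrite negb_or; apply/andP; split; first by rewrite neq_ltn (leq_trans vm).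
apply/existsPn => e; apply/negP => /andP[re /eqP fe].
have [em|em] := ltnP e.1.+1 m; first exact: (lowv e).
by apply: (cutv e) => //; rewrite inE em re fe.
Qed.

Lemma reach_cut m f e : e \in cut m f -> reach f (f e).
Proof. by rewrite inE => /and3P[_ re _]; apply: reach_arrow re _. Qed.

Lemma reach_next k f : f \in family tgt -> (k < N)%N ->
  reach f k = [exists e in cut k.+1 f, f e == k :> nat].
Proof.
move=> /tgtP ft kN; rewrite reach_rec 1?ltnW // ltn_eqF //=.
apply: eq_existsb => e; rewrite inE; have [fe|] := eqVneq (f e : nat) k;
  last by rewrite !andbF.
by rewrite fe ltnSn !andbT -fe ltnS ft.
Qed.

(** Given the past the cut is fixed, and its arrows, starting outside [m], end independently and
    uniformly on [m]; all other coordinates contribute a factor 1. *)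
Lemma mean_cut m f (g : 'I_N -> R) : (0 < m <= N)%N ->
  mean (low_tgt m) (fun t => \prod_(e in cut m f) g (t e)) =
  (m%:R^-1 * \sum_(j | low m j) g j) ^+ #|cut m f|.
Proof.
move=> /andP[m0 mN]; rewrite -prodr_const.
under eq_mean do rewrite big_mkcond /=.
rewrite (mean_prod _ (fun e j => if e \in cut m f then g j else 1)).
rewrite [RHS]big_mkcond; apply: eq_bigr => e _; case: ifP => [|_].
  rewrite inE => /and3P[me _ _].
  rewrite (eq_card (low_tgt_above me)) card_low //; congr (_ * _).
  exact/eq_bigl/low_tgt_above.
rewrite sumr_const mulVf // pnatr_eq0 -lt0n; exact: card_low_tgt_gt0.
Qed.

End Configurations.

(** * The generating function of Y_m and its recursion *)

Section Generating.
Context {R : realFieldType} (d N : nat).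
Implicit Types (f t : {ffun 'I_N * 'I_d -> 'I_N}) (s : R).

(** The probability generating function E s^Y_m. *)
Definition phi m s : R := mean (@tgt d N) (fun f => s ^+ #|cut m f|).

Lemma sum_low m (u : nat) (a b : R) : (u < m.+1 <= N)%N ->
  \sum_(j : 'I_N | low m.+1 j) (if j == u :> nat then a else b) = a + m%:R * b
  :> R.
Proof.
move=> /andP[um mN]; have uN := leq_trans um mN.
rewrite (bigD1 (Ordinal uN)) //= eqxx; congr (_ + _).
rewrite (eq_bigr (fun=> b)) => [|j /andP[_ ju]]; last first.
  by rewrite (negbTE (ju : (j != u :> nat))).
rewrite sumr_const mulr_natl; congr (_ *+ _).
have := card_low mN.
rewrite (cardD1 (Ordinal uN) (low m.+1)) [_ \in low _]um => -[cm].
rewrite -[RHS]cm.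
by apply: eq_card => j; rewrite !inE andbC.
Qed.

Lemma resample_mean m (F : {ffun 'I_N * 'I_d -> 'I_N} -> R) : (0 < m)%N ->
  mean (@tgt d N) F = mean (@tgt d N) (fun f =>
    mean (low_tgt m) (fun t => F (resample (low m) f t))).
Proof. by move=> m0; apply: mean_resample => e; apply: card_low_tgt_gt0. Qed.

Lemma phi_ge0 m s : 0 <= s -> 0 <= phi m s.
Proof. by move=> s0; apply: mean_ge0 => f; rewrite exprn_ge0. Qed.

Lemma phi1 m : phi m 1 = 1.
Proof.
rewrite /phi; under eq_mean do rewrite expr1n.
exact/mean_cst/card_tgt_gt0.
Qed.

Lemma card_out_arrows v : (0 < v <= N)%N ->
  #|[set e : 'I_N * 'I_d | e.1.+1 == v]| = d.
Proof.
move=> v0N; have vN : (v.-1 < N)%N by lia.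
rewrite -[RHS]card_ord -(card_codom (f := fun i : 'I_d => (Ordinal vN, i))).
  apply: eq_card => -[i j]; rewrite inE /=.
  apply/eqP/codomP => [iv|[j' [-> _]] /=]; last by lia.
  by exists j; congr pair; apply/val_inj; rewrite /= -iv.
by move=> i j [].
Qed.

(** The only source outside [N] = [n - 1] is n, and all its d arrows cross. *)
Lemma phi_top s : (0 < N)%N -> phi N s = s ^+ d.
Proof.
move=> N0; rewrite -[RHS](mean_cst _ (@card_tgt_gt0 d N)).
apply: eq_mean => f _; congr (_ ^+ _); rewrite -[RHS](@card_out_arrows N).
  apply: eq_card => e; rewrite !inE ltn_ord andbT.
  have [->|ne] := eqVneq e.1.+1 N; first by rewrite leqnn reach_root.
  by have := ltn_ord e.1; rewrite leq_eqVlt (negbTE ne) ltnNge => /negbTE ->.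
by rewrite N0 /=.
Qed.

(** Given the past, each cut arrow misses u with probability m/(m+1), independently. *)
Lemma phi_avoid m (u : nat) : (u < m.+1 <= N)%N ->
  mean (@tgt d N) (fun f => [forall e in cut m.+1 f, f e != u :> nat]%:R) =
  phi m.+1 (m%:R / m.+1%:R) :> R.
Proof.
move=> um; have /andP[_ mN] := um.
rewrite (@resample_mean m.+1) //; apply: eq_mean => f ft.
rewrite (eq_mean (F' := fun t => \prod_(e in cut m.+1 f)
  (if t e == u :> nat then 0 else 1))); last first.
  move=> t tt; rewrite cut_resample //.
  case: (boolP [forall e in _, _]) => [/forall_inP av|/forall_inPn[e ef]].
    rewrite big1 // => e ef; have := av e ef; rewrite ffunE.
    by move: ef; rewrite inE => /and3P[_ _ fe]; rewrite ifT // => /negbTE ->.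
  rewrite negbK ffunE ifT => [/eqP te|]; last first.
    by move: ef; rewrite inE => /and3P[].
  by rewrite (bigD1 e) //= te eqxx mul0r.
rewrite (mean_cut _ (fun j : 'I_N => if j == u :> nat then 0 else 1)) //.
by rewrite sum_low // add0r mulr1 mulrC.
Qed.

(* Revealing the vertex k: if none of the pending arrows hits it, their number
   is unchanged; otherwise those hitting it are replaced by its d arrows. *)
Lemma card_cut_resample k f t : (0 < k < N)%N ->
  f \in family (@tgt d N) -> t \in family (low_tgt k.+1) ->
  #|cut k (resample (low k.+1) f t)| =
    (#|[set e in cut k.+1 f | t e != k :> nat]| +
     [exists e in cut k.+1 f, t e == k :> nat] * d)%N.
Proof.
move=> /andP[k0 kN] ft tt; set f' := resample _ f t.
have ft' : f' \in family (@tgt d N) by exact: resample_tgt.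
have reachk : reach f' k = [exists e in cut k.+1 f, t e == k :> nat].
  rewrite reach_next // cut_resample //; apply: eq_existsb => e.
  rewrite inE ffunE /low /=; case: (ltnP (f e) k.+1) => //= _.
  by rewrite !andbF.
rewrite -reachk.
rewrite -[#|cut k f'|](cardsID [set e : 'I_N * 'I_d | e.1.+1 == k]) addnC.
congr (_ + _)%N.
  apply: eq_card => e; rewrite !inE ffunE.
  have [->|ek] := eqVneq e.1.+1 k; first by rewrite ltnn.
  have -> : (k < e.1.+1)%N = (k <= e.1.+1)%N.
    by rewrite [RHS]leq_eqVlt eq_sym (negbTE ek).
  case: (leqP k e.1.+1) => //= ke; rewrite reach_resample //; last first.
    by rewrite ltn_neqAle eq_sym ek ke /=.
  case: (reach _ _) => //=; rewrite /low /=.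
  case: (ltnP (f e) k.+1) => [_|fe] /=; last by rewrite ltnNge (ltnW fe).
  by rewrite ltn_neqAle -ltnS; have /low_tgtP/(_ e)[_ ->] := tt; rewrite andbT.
case: (reach f' k) / boolP => [rk|nrk]; last first.
  apply/eqP; rewrite mul0n cards_eq0; apply/eqP/setP => e; rewrite !inE.
  by case: eqVneq => [->|]; rewrite ?(negbTE nrk) ?andbF.
rewrite mul1n -[RHS](@card_out_arrows k); last by rewrite k0 ltnW.
apply: eq_card => e; rewrite !inE andbC; case: eqVneq => //= ek.
by rewrite -{1 2}ek leqnn ek rk -[X in (_ < X)%N]ek ltnS; move/tgtP: ft'; apply.
Qed.

(** Give the pending arrows that hit k the weight a and the others the weight s. With a = 1 the
    product counts the arrows that survive; with a = 0 it is s^Y when k is not hit and 0 otherwise.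
    Combining them with coefficients s^d and 1 - s^d is right in both cases. *)
Lemma phi_step k s : (0 < k < N)%N ->
  phi k s = s ^+ d * phi k.+1 ((1 + k%:R * s) / k.+1%:R) +
            (1 - s ^+ d) * phi k.+1 (k%:R * s / k.+1%:R).
Proof.
move=> kN; have /andP[_ kN'] := kN.
rewrite /phi -!meanZ -meanD (@resample_mean k.+1) //; apply: eq_mean => f ft.
pose g a := mean (low_tgt k.+1) (fun t => \prod_(e in cut k.+1 f)
  (if t e == k :> nat then a else s)).
have gE a : ((a + k%:R * s) / k.+1%:R) ^+ #|cut k.+1 f| = g a.
  rewrite /g (mean_cut _ (fun j : 'I_N => if j == k :> nat then a else s)) //.
  by rewrite sum_low 1?mulrC // ltnSn.
(* The second argument is read as (0 + k s)/(k+1), so that [gE] applies with a = 0 as well as a =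
   1. *)
rewrite -[k%:R * s]add0r add0r -{2}[k%:R * s]add0r !gE /g -!meanZ -meanD.
apply: eq_mean => t tt; rewrite card_cut_resample // exprD.
have prodE a : \prod_(e in cut k.+1 f) (if t e == k :> nat then a else s) =
    s ^+ #|[set e in cut k.+1 f | t e != k :> nat]| *
    \prod_(e in cut k.+1 f | t e == k :> nat) a.
  rewrite (bigID (fun e => t e == k :> nat)) /= mulrC; congr (_ * _).
    rewrite -prodr_const; apply: eq_big => e; first by rewrite inE.
    by move=> /andP[_ /negbTE ->].
  by apply: eq_bigr => e /andP[_ ->].
rewrite !prodE big1 // mulr1.
case: existsP => [[e /andP[ef te]]|nex].
  by rewrite (bigD1 e) ?ef //= mul0r !mulr0 addr0 mulrC mul1n.
rewrite big1 => [|e /andP[ef te]].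
  by rewrite mul0n expr0 !mulr1; ring.
by case: nex; exists e; rewrite ef.
Qed.

End Generating.

(** * Consequences of the recursion, and the union bound *)

Section Bounds.
Context {R : realFieldType} (d N : nat).
Implicit Types (f t : {ffun 'I_N * 'I_d -> 'I_N}) (s : R).

Local Notation phi := (@phi R d N).
Local Notation tgt := (@tgt d N).

Definition potential k : R :=
  \sum_(1 <= c < k) phi k (c%:R / k%:R) / c%:R ^+ d.

(** The recursion sends c/k to (c+1)/(k+1) and c/(k+1). Dividing by c^d gives the difference F(c+1)
    - F(c) the coefficient 1/k^d, free of c, so these terms telescope; the two sides then differ by
    F(1)/k^d >= 0. *)
Lemma potential_step k : (0 < k < N)%N -> potential k <= potential k.+1.
Proof.
move=> /andP[k0 kN]; have k0' : k%:R != 0 :> R by rewrite pnatr_eq0 -lt0n.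
pose F c : R := phi k.+1 (c%:R / k.+1%:R).
rewrite /potential big_nat_recr //=.
have -> : \sum_(1 <= c < k) phi k (c%:R / k%:R) / c%:R ^+ d =
    \sum_(1 <= c < k) (F c / c%:R ^+ d + (F c.+1 - F c) / k%:R ^+ d).
  apply: eq_big_nat => c /andP[c0 ck]; rewrite phi_step ?k0 //.
  have c0' : c%:R != 0 :> R by rewrite pnatr_eq0 -lt0n.
  have -> : k%:R * (c%:R / k%:R) = c%:R :> R by rewrite mulrCA divff // mulr1.
  rewrite nat1r -/(F c) -/(F c.+1) expr_div_n.
  have ckd : c%:R ^+ d != 0 :> R by rewrite expf_neq0.
  have kkd : k%:R ^+ d != 0 :> R by rewrite expf_neq0.
  by field; rewrite ckd kkd.
rewrite big_split /= lerD2l -mulr_suml telescope_sumr // ler_pM2r; last first.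
  by rewrite invr_gt0 exprn_gt0 // ltr0n.
by rewrite gerBl phi_ge0.
Qed.

(** At the top level each of the N - 1 terms equals 1/N^d. *)
Lemma potential_le k : (0 < k <= N)%N -> potential k <= N%:R / N%:R ^+ d.
Proof.
move=> /andP[k0 kN]; have N0 := leq_trans k0 kN.
have N0' : N%:R != 0 :> R by rewrite pnatr_eq0 -lt0n.
have /le_trans : potential k <= potential N.
  have [j] := ubnP (N - k); elim: j k k0 kN => // j IH k k0 kN Nkj.
  have [->//|ltN] := eqVneq k N; have kN' : (k < N)%N by rewrite ltn_neqAle ltN.
  by apply: le_trans (potential_step _) (IH _ _ _ _) => //; rewrite ?k0 //; lia.
apply; rewrite /potential.
under eq_big_nat => c /andP[c0 _].
  rewrite phi_top // expr_div_n mulrAC divff ?expf_neq0 ?pnatr_eq0 -?lt0n //.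
  rewrite mul1r; over.
rewrite sumr_const_nat -[leLHS]mulr_natl; apply: ler_wpM2r.
  by rewrite invr_ge0 exprn_ge0.
by rewrite ler_nat leq_subr.
Qed.

(** Keep only the last term, c = k, of the potential at k+1. *)
Lemma phi_avoid_le k : (0 < k < N)%N ->
  phi k.+1 (k%:R / k.+1%:R) <= k%:R ^+ d * (N%:R / N%:R ^+ d).
Proof.
move=> /andP[k0 kN]; have k0' : 0 < k%:R ^+ d :> R by rewrite exprn_gt0 ?ltr0n.
rewrite -ler_pdivrMl // [leLHS]mulrC; apply: le_trans (@potential_le k.+1 kN).
rewrite /potential big_nat_recr //= lerDr; apply: sumr_ge0 => c _.
by rewrite divr_ge0 ?exprn_ge0 ?phi_ge0 ?divr_ge0.
Qed.

(** The argument (k+1)/k becomes (k+2)/(k+1), of the same form, in the first term of the recursion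
    and 1 in the second. Hence k^d times the excess over 1 does not depend on k. *)
Lemma phi_succ_ratio k : (0 < k <= N)%N ->
  phi k (k.+1%:R / k%:R) = 1 + (N.+1%:R ^+ d - N%:R ^+ d) / k%:R ^+ d.
Proof.
move=> /andP[k0 kN]; have [j] := ubnP (N - k).
elim: j k k0 kN => // j IH k k0 kN.
move=> Nkj; have k0' : k%:R != 0 :> R by rewrite pnatr_eq0 -lt0n.
have kd0 : k%:R ^+ d != 0 :> R by rewrite expf_neq0.
have [eN|ltN] := eqVneq k N.
  by rewrite {1}eN phi_top -?eN // expr_div_n; field; rewrite kd0.
rewrite phi_step ?k0 ?ltn_neqAle ?ltN //.
have -> : k%:R * (k.+1%:R / k%:R) = k.+1%:R :> R by rewrite mulrCA divff ?mulr1.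
rewrite nat1r divff ?pnatr_eq0 // phi1 IH //; [|lia..].
rewrite expr_div_n mulr1.
have kS : k.+1%:R ^+ d != 0 :> R by rewrite expf_neq0 // pnatr_eq0.
by field; rewrite kS kd0.
Qed.

Definition missed m f : bool :=
  [exists v : 'I_N.+1, (v < m)%N && ~~ reach f v].

Lemma missed_mono m m' f : (m <= m')%N -> missed m f -> missed m' f.
Proof.
move=> mm' /existsP[v /andP[vm nv]]; apply/existsP; exists v.
by rewrite (leq_trans vm mm').
Qed.

(** Union bound: the end of a cut arrow is a descendant, so all cut arrows avoid a missed vertex. *)
Lemma missed_le m : (1 < m)%N -> (0 < N)%N ->
  mean tgt (fun f => (missed m f)%:R) <= m%:R ^+ d.+1 * (N%:R / N%:R ^+ d) :> R.
Proof.
(* For m > N the right-hand side is at least 1. *)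
move=> m1 N0; have [mN|Nm] := leqP m N; last first.
  apply: (@le_trans _ _ 1).
    rewrite -[leRHS](mean_cst 1 (@card_tgt_gt0 d N)).
    by apply: le_mean => f _; rewrite lern1 leq_b1.
  have N0' : 0 < N%:R ^+ d :> R by rewrite exprn_gt0 ?ltr0n.
  rewrite mulrA ler_pdivlMr // mul1r exprS mulrAC -[leLHS]mul1r.
  apply: ler_pM => //; first by rewrite -natrM ler1n muln_gt0 N0 ltnW.
  by apply: lerXn2r; rewrite ?nnegrE // ler_nat ltnW.
case: m => // k in m1 mN *.
apply: (@le_trans _ _ (\sum_(u < k.+1) phi k.+1 (k%:R / k.+1%:R))).
  have -> : \sum_(u < k.+1) phi k.+1 (k%:R / k.+1%:R) = mean tgt (fun f =>
      \sum_(u < k.+1) [forall e in cut k.+1 f, f e != u :> nat]%:R).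
    rewrite mean_sum; apply: eq_bigr => u _; rewrite phi_avoid //.
    by rewrite ltn_ord.
  apply: le_mean => f _.
  case: (boolP (missed _ f)) => [/existsP[v /andP[vk nv]]|_]; last first.
    by rewrite sumr_ge0.
  rewrite (bigD1 (Ordinal vk)) //=.
  suff -> : [forall e in cut k.+1 f, f e != v :> nat] by rewrite lerDl sumr_ge0.
  apply/forall_inP => e ef; apply: contraNneq nv => <-.
  exact: reach_cut ef.
rewrite sumr_const card_ord -[leLHS]mulr_natl exprS -mulrA.
apply: ler_wpM2l => //.
apply: le_trans (phi_avoid_le _) _; first by rewrite mN andbT.
apply: ler_wpM2r; first by rewrite divr_ge0 ?exprn_ge0.
by apply: lerXn2r; rewrite ?nnegrE // ler_nat.
Qed.

End Bounds.

(** * Second moment estimate given the past *)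

Section SecondMoment.
Context {R : realFieldType} (d N : nat).
Implicit Types (f t : {ffun 'I_N * 'I_d -> 'I_N}).

(** The factors with i < u are 1; the others, i/(i+1), telescope. *)
Lemma prod_ratio u k : (0 < u <= k)%N ->
  \prod_(i < k) (1 - (u <= i)%:R / i.+1%:R) = u%:R / k%:R :> R.
Proof.
move=> /andP[u0]; elim: k => [|k IH]; first by rewrite leqNgt u0.
rewrite leq_eqVlt ltnS => /predU1P[->|uk].
  rewrite divff ?pnatr_eq0 // big1 // => i _.
  by rewrite leqNgt ltn_ord mul0r subr0.
rewrite big_ord_recr /= IH // uk mulr1n.
have k0 : k%:R != 0 :> R by rewrite pnatr_eq0 -lt0n (leq_trans u0).
by rewrite -(natr1 k); field; rewrite natr1 pnatr_eq0 k0.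
Qed.

Definition exposed m f : {set 'I_N * 'I_d} :=
  cut m f :|: [set e : 'I_N * 'I_d | e.1.+1 < m]%N.

Lemma missed_exposed m f t (u : 'I_N) : (u < m <= N)%N ->
  f \in family (@tgt d N) -> t \in family (low_tgt m) ->
  avoids (exposed m f) u t -> missed m (resample (low m) f t).
Proof.
move=> /andP[um mN] ft tt /forall_inP av.
apply/existsP; exists (widen_ord (leqnSn N) u); rewrite um /=.
have neq e : (f e < m)%N -> e \in exposed m f ->
    resample (low m) f t e <> u :> nat.
  by move=> fe /av te; rewrite ffunE ifT // => /val_inj/eqP; apply/negP.
apply: (@reach_above _ _ m); rewrite ?um ?resample_tgt // => e.
  rewrite cut_resample // => ef; apply: neq; last by rewrite inE ef.
  by move: ef; rewrite inE => /and3P[].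
move=> em; apply: neq; last by rewrite !inE em orbT.
by move/tgtP: ft => /(_ e)/leq_ltn_trans -> //; apply: ltnW.
Qed.

(** Each cut arrow misses u with probability (m-1)/m; for each of the d labels, the arrows inside
    [m] give the telescoping product u/(m-1). *)
Lemma mean_exposed m f (u : 'I_N) : (0 < u < m)%N -> (m <= N)%N ->
  mean (low_tgt m) (fun t => (avoids (exposed m f) u t)%:R) =
  (m.-1%:R / m%:R) ^+ #|cut m f| * (u%:R / m.-1%:R) ^+ d :> R.
Proof.
move=> /andP[u0 um] mN; have m0 : (0 < m)%N by lia.
rewrite mean_avoids => [|e]; last exact: card_low_tgt_gt0.
rewrite (bigID (mem (cut m f))) /=; congr (_ * _).
  rewrite -prodr_const; apply: eq_big => e.
    by rewrite !inE andb_idl // => ->.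
  move=> /andP[_]; rewrite inE => /and3P[me _ _].
  rewrite (eq_card (low_tgt_above me)) card_low // low_tgt_above //.
  have -> : low m u = true := um.
  rewrite -[in RHS](ltn_predK um) -[in LHS](ltn_predK um) /=.
  by rewrite mulr1n -(natr1 m.-1); field; rewrite natr1 pnatr_eq0.
rewrite -(@prod_ratio u m.-1); last by rewrite u0 -ltnS (ltn_predK um).
have m1N : (m.-1 <= N)%N := leq_trans (leq_pred m) mN.
transitivity (\prod_(e : 'I_N * 'I_d | (e.1 < m.-1)%N && true)
    (1 - (u <= e.1)%:R / e.1.+1%:R) : R).
  apply: eq_big => [e|e /andP[]].
    by rewrite !inE; case: (leqP m e.1.+1) => /= em; lia.
  rewrite !inE => /orP[-> //|em _].
  rewrite (eq_card (low_tgt_below (ltnW em))) (low_tgt_below (ltnW em)).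
  by congr (1 - _ / _%:R); rewrite -[RHS](@card_low N).
rewrite -(pair_big (fun i : 'I_N => i < m.-1)%N xpredT
  (fun i _ => 1 - (u <= i)%:R / i.+1%:R)) /=.
rewrite (big_ord_widen _ (fun i => 1 - (u <= i)%:R / i.+1%:R) m1N) -prodrXl.
by apply: eq_bigr => i _; rewrite prodr_const card_ord.
Qed.

Lemma card_window h m : (m <= N)%N -> 
  #|[pred u : 'I_N | (h <= u < m)%N]| = (m - h)%N.
Proof.
move=> mN; rewrite -[RHS]card_ord.
have lt_N (i : 'I_(m - h)) : (h + i < N)%N by have := ltn_ord i; lia.
rewrite -(card_codom (f := fun i => Ordinal (lt_N i))); last first.
  by move=> i j /(congr1 val)/= /addnI ij; apply/val_inj.
apply: eq_card => u; rewrite inE; apply/andP/codomP => [[hu um]|[i ->]] /=.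
  have lt_u : (u - h < m - h)%N by lia.
  by exists (Ordinal lt_u); apply/val_inj; rewrite /= subnKC.
by have := ltn_ord i; lia.
Qed.

(** Only the upper half of [2h] is counted: there u/(2h-1) >= 1/2, so the mean number of missed
    vertices is at least h c, and Chebyshev gives 1/(h c). *)
Lemma present_resample_le h f : (0 < h)%N -> (h.*2 <= N)%N ->
  f \in family (@tgt d N) ->
  mean (low_tgt h.*2)
    (fun t => (~~ missed h.*2 (resample (low h.*2) f t))%:R) <=
  2%:R ^+ d / h%:R * (h.*2%:R / h.*2.-1%:R) ^+ #|cut h.*2 f| :> R.
Proof.
move=> h0 mN ft; set m := h.*2 in mN *; set Y := #|_|.
have m1 : (1 < m)%N by rewrite /m; lia.
pose B := [pred u : 'I_N | (h <= u < m)%N].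
have m_gt0 : 0 < m%:R :> R by rewrite ltr0n; lia.
have m1_gt0 : 0 < m.-1%:R :> R by rewrite ltr0n; lia.
have h_gt0 : 0 < h%:R :> R by rewrite ltr0n.
pose c : R := (m.-1%:R / m%:R) ^+ Y * 2%:R^-1 ^+ d.
have c_gt0 : 0 < c by rewrite mulr_gt0 ?exprn_gt0 ?invr_gt0 ?divr_gt0.
have ge_c : h%:R * c <=
    \sum_(u | B u) mean (low_tgt m) (fun t => (avoids (exposed m f) u t)%:R).
  have -> : h%:R * c = \sum_(u | B u) c.
    rewrite sumr_const card_window // mulr_natl; congr (_ *+ _).
    by rewrite /m; lia.
  apply: ler_sum => u /andP[hu um]; rewrite mean_exposed //; last by lia.
  rewrite /c ler_wpM2l ?exprn_ge0 ?divr_ge0 // lerXn2r ?nnegrE ?divr_ge0 //.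
  by rewrite ler_pdivlMr // ler_pdivrMl // -natrM ler_nat; lia.
have card0 (e : 'I_N * 'I_d) : (0 < #|low_tgt m e|)%N.
  by apply: card_low_tgt_gt0; lia.
have := @mean_none R _ _ _ _ B (avoids (exposed m f)) card0
  (fun u w => mean_avoids2 _ card0).
set none := mean _ _; move=> mu_none.
apply: (@le_trans _ _ none).
  apply: le_mean => t tt; rewrite ler_nat.
  case: (boolP (missed _ _)) => //= nmiss; rewrite lt0b.
  apply/forall_inP => u /andP[_ um]; apply: contra nmiss.
  by apply: missed_exposed => //; rewrite um.
have none_ge0 : 0 <= none by apply: mean_ge0.
have : (h%:R * c) * none <= 1.
  by apply: le_trans mu_none; apply: ler_wpM2r.
have hc_gt0 : 0 < h%:R * c by rewrite mulr_gt0.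
rewrite mulrC -ler_pdivlMr // => /le_trans; apply.
rewrite le_eqVlt; apply/orP; left; apply/eqP.
rewrite /c !expr_div_n exprVn; field.
by rewrite !expf_neq0 ?lt0r_neq0.
Qed.

End SecondMoment.

(** * Averaging the second moment estimate *)

Section Present.
Context {R : realType} (d N : nat).

Lemma bernoulli_le (x : R) n : 0 <= x -> 1 + n%:R * x <= (1 + x) ^+ n.
Proof.
move=> x0; elim: n => [|n IH]; first by rewrite mul0r addr0 expr0.
rewrite exprS -natr1; have x1 : 0 <= 1 + x by rewrite addr_ge0.
apply: le_trans (ler_wpM2l x1 IH); rewrite -subr_ge0.
have -> : (1 + x) * (1 + n%:R * x) - (1 + (n%:R + 1) * x) = n%:R * x ^+ 2.
  by ring.
by rewrite mulr_ge0 ?sqr_ge0.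
Qed.

(* Up to Y = m^2 the two powers differ by a factor at most e; beyond m^2 the
   right-hand side exceeds 1. *)
Lemma ratio_trade (h Y : nat) (A x : R) : (0 < h)%N -> 1 <= A -> x <= 1 ->
  x <= A / h%:R * (h.*2%:R / h.*2.-1%:R) ^+ Y ->
  x <= expR 1 * (A / h%:R) * (h.*2.+1%:R / h.*2%:R) ^+ Y.
Proof.
move=> h0 A1 x1 xle; have hR : 0 < h%:R :> R by rewrite ltr0n.
pose k := h.*2.-1; have mk : h.*2 = k.+1 by rewrite /k; lia.
have k0 : (0 < k)%N by rewrite /k; lia.
rewrite mk /= in xle *.
have kR : 0 < k%:R :> R by rewrite ltr0n.
have k1R : 0 < k.+1%:R :> R by rewrite ltr0n.
have k2R : 0 < k.+2%:R :> R by rewrite ltr0n.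
have Ah : 0 < A / h%:R by rewrite divr_gt0 // (lt_le_trans ltr01).
(* With m = k+1 the cutoff is m^2 - 1: the two bases have ratio 1 + 1/(k(k+2)), whose Y-th power is
   at most e for Y <= k(k+2). *)
have [Yq|qY] := leqP Y (k * k.+2).
  apply: le_trans xle _; rewrite [expR 1 * _]mulrC -[leRHS]mulrA.
  apply: ler_wpM2l; first exact: ltW.
  have -> : k.+1%:R / k%:R = (1 + (k * k.+2)%:R^-1) * (k.+2%:R / k.+1%:R) :> R.
    rewrite natrM -!natr1; field.
    by rewrite !natr1 !pnatr_eq0 /= -lt0n.
  rewrite exprMn; apply: ler_wpM2r; first by rewrite exprn_ge0 ?divr_ge0.
  have qR : 0 < (k * k.+2)%:R :> R by rewrite ltr0n muln_gt0 k0.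
  apply: (@le_trans _ _ (expR (k * k.+2)%:R^-1 ^+ Y)).
    apply: lerXn2r (expR_ge1Dx _); by rewrite nnegrE ?expR_ge0.
  by rewrite -expRM_natl ler_expR ler_pdivrMr // mul1r ler_nat.
apply: (le_trans x1); rewrite -mulrA.
have e1 : 1 <= expR 1 :> R by apply: le_trans (expR_ge1Dx 1); rewrite lerDl.
rewrite -[leLHS]mulr1; apply: ler_pM => //.
rewrite mulrAC ler_pdivlMr // mul1r.
(* Since Y >= (k+1)^2, Bernoulli bounds the power below by k+2, which exceeds h. *)
apply: (@le_trans _ _ (k.+2%:R)); first by rewrite ler_nat; lia.
rewrite -[leLHS]mul1r; apply: ler_pM => //.
have -> : k.+2%:R / k.+1%:R = 1 + k.+1%:R^-1 :> R.
  by rewrite -(natr1 k.+1) mulrDl divff ?mul1r // lt0r_neq0.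
apply: le_trans (bernoulli_le _ _); last by rewrite invr_ge0.
by rewrite -(natr1 k.+1) addrC lerD2l ler_pdivlMr // -natrM ler_nat; lia.
Qed.

(** Chebyshev yields powers of m/(m-1), m = 2h, but E s^Y_m has a closed form at s = (m+1)/m;
    [ratio_trade] passes from one to the other at the cost of a factor e. *)
Lemma present_le h : (0 < h)%N -> (h.*2 <= N)%N ->
  mean (@tgt d N) (fun f => (~~ missed h.*2 f)%:R) <=
  expR 1 * (2%:R ^+ d / h%:R) *
    (1 + (N.+1%:R ^+ d - N%:R ^+ d) / h.*2%:R ^+ d) :> R.
Proof.
move=> h0 hN; rewrite -phi_succ_ratio; last by rewrite hN andbT; lia.
rewrite (@resample_mean _ _ _ h.*2) -?meanZ; last by lia.
apply: le_mean => f ft; apply: ratio_trade => //.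
- by rewrite exprn_ege1 // ler1n.
- rewrite -[leRHS](mean_cst 1 (fun e => @card_low_tgt_gt0 d N h.*2 e _)).
    2: by lia.
  by apply: le_mean => t _; rewrite lern1 leq_b1.
- exact: present_resample_le.
Qed.

End Present.

(** * From random DAGs to configurations *)

Section Transfer.
Context {R : realType} (d N : nat).

(** The dependent type [dag] is traded for plain functions; the range of each target moves into
    [family tgt]. *)
Definition to_cfg (G : dag d N.+1) : {ffun 'I_N * 'I_d -> 'I_N} :=
  [ffun e => widen_ord (ltn_ord e.1) (G e.1 e.2)].

(** The default value of [inord] is taken only when f is outside [family tgt]. *)
Definition of_cfg (f : {ffun 'I_N * 'I_d -> 'I_N}) : dag d N.+1 :=
  [ffun i : 'I_N => [ffun k : 'I_d => inord (f (i, k)) : 'I_i.+1]].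

Lemma to_cfg_tgt G : to_cfg G \in family (@tgt d N).
Proof. by apply/tgtP => e; rewrite ffunE /= -ltnS. Qed.

Lemma of_cfgK f : f \in family (@tgt d N) -> to_cfg (of_cfg f) = f.
Proof.
move=> /tgtP ft; apply/ffunP => -[i k]; apply/val_inj.
by rewrite !ffunE /= inordK // ltnS; apply: (ft (i, k)).
Qed.

Lemma to_cfgK : cancel to_cfg of_cfg.
Proof.
move=> G; apply/ffunP => i; rewrite ffunE; apply/ffunP => k; apply/val_inj.
by rewrite !ffunE /= inord_val.
Qed.

Lemma card_tgt e : #|@tgt d N e| = e.1.+1.
Proof. by rewrite -[RHS](@card_low N). Qed.

Lemma dag_law_cst (G : dag d N.+1) :
  dag_law R G = (\prod_e #|@tgt d N e|%:R)^-1.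
Proof.
rewrite /dag_law pair_bigA /= -prodfV.
by apply: eq_bigr => e _; rewrite card_tgt.
Qed.

Lemma dag_prob_mean (P : pred {ffun 'I_N * 'I_d -> 'I_N}) :
  dag_prob R [pred G : dag d N.+1 | P (to_cfg G)] =
  mean (@tgt d N) (fun f => (P f)%:R).
Proof.
rewrite /dag_prob /mean mulr_sumr (reindex_onto to_cfg of_cfg of_cfgK).
rewrite [RHS](eq_bigl xpredT) => [|G]; last by rewrite to_cfg_tgt to_cfgK eqxx.
rewrite big_mkcond; apply: eq_bigr => G _; rewrite dag_law_cst /=.
by case: (P _); rewrite ?mulr1 ?mulr0.
Qed.

Lemma arrow_cfg (G : dag d N.+1) : arrow G =2 cfg_arrow (to_cfg G).
Proof.
move=> u v; apply/existsP/existsP => [[i /existsP[k uv]]|[[i k] uv]].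
  by exists (i, k); rewrite ffunE.
by exists i; apply/existsP; exists k; move: uv; rewrite ffunE.
Qed.

Lemma descendantsE (G : dag d N.+1) (j : 'I_N.+1) :
  (j \in descendants G) = reach (to_cfg G) j.
Proof.
rewrite inE; apply/existsP/existsP.
  case=> r /andP[/eqP[rN] rj]; exists j.
  rewrite eqxx -(eq_connect (arrow_cfg G)).
  by have <- : r = ord_max by apply/val_inj.
case=> w /andP[/eqP wj cw].
exists ord_max; rewrite eqxx (eq_connect (arrow_cfg G)).
by have <- : w = j by apply/val_inj.
Qed.

Lemma meets_missed m (G : dag d N.+1) :
  meets_initial m (~: descendants G) = missed m (to_cfg G).
Proof.
apply/set0Pn/existsP => [[i]|[i /andP[im ni]]].
  rewrite finset.in_setI finset.in_setC descendantsE inE => /andP[ni im].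
  by exists i; rewrite im.
by exists i; rewrite finset.in_setI finset.in_setC descendantsE ni inE.
Qed.

Lemma prob_meets m :
  dag_prob R [pred G : dag d N.+1 | meets_initial m (~: descendants G)] =
  mean (@tgt d N) (fun f => (missed m f)%:R).
Proof.
by rewrite -dag_prob_mean; apply: eq_bigl => G; rewrite !inE meets_missed.
Qed.

End Transfer.

(** * Explicit bounds in n and m, with d = c + 1 *)

Section Estimates.
Context {R : realType} (c : nat).

Lemma prob_meets_le n m : (0 < c)%N -> (1 < n)%N ->
  dag_prob R [pred G : dag c.+1 n | meets_initial m (~: descendants G)] <=
  2%:R ^+ c * (m%:R ^+ c.+2 / n%:R ^+ c + 2%:R ^+ c.+2 / n%:R).
Proof.
case: n => [//|[//|N]] c0 _; rewrite prob_meets.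
set n := N.+2; have nR : 0 < n%:R :> R by rewrite ltr0n.
have NR : 0 < N.+1%:R :> R by rewrite ltr0n.
(* Raising m to at least 2 allows [missed_le]; it costs 2^(c+2)/n^c, which is at most 2^(c+2)/n as c
   > 0. The factor 2^c comes from n <= 2(n-1). *)
apply: (@le_trans _ _ (mean (@tgt c.+1 N.+1)
    (fun f => (missed (maxn m 2) f)%:R))).
  apply: le_mean => f _; rewrite ler_nat; case: (boolP (missed m f)) => // mf.
  by rewrite (missed_mono (leq_maxl m 2) mf).
apply: (le_trans (missed_le _ _ _)); rewrite ?leq_maxr //.
have -> : N.+1%:R / N.+1%:R ^+ c.+1 = (N.+1%:R ^+ c)^-1 :> R.
  by rewrite exprS invfM mulrA divff ?mul1r // lt0r_neq0.
have le_max : (maxn m 2)%:R ^+ c.+2 <= m%:R ^+ c.+2 + 2%:R ^+ c.+2 :> R.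
  by rewrite /maxn; case: ifP => _; rewrite ?lerDl ?lerDr exprn_ge0.
apply: (@le_trans _ _
    ((m%:R ^+ c.+2 + 2%:R ^+ c.+2) * (2%:R ^+ c / n%:R ^+ c))).
  apply: ler_pM => //; rewrite ?invr_ge0 ?exprn_ge0 //.
  rewrite ler_pdivlMr ?exprn_gt0 // mulrC ler_pdivrMr ?exprn_gt0 // -exprMn.
  by apply: lerXn2r; rewrite ?nnegrE // -natrM ler_nat /n; lia.
rewrite mulrCA; apply: ler_wpM2l; first exact: exprn_ge0.
rewrite mulrDl lerD2l; apply: ler_wpM2l; first exact: exprn_ge0.
rewrite lef_pV2 ?posrE ?exprn_gt0 // -[leLHS]expr1.
by apply: ler_weXn2l => //; rewrite ler1n.
Qed.

Lemma prob_meets_ge n m : (2 < n)%N -> (1 < m)%N ->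
  1 - dag_prob R [pred G : dag c.+1 n | meets_initial m (~: descendants G)] <=
  expR 1 * 2%:R ^+ c.+1 * (3%:R * (m%:R^-1 + 2%:R / n%:R) +
    c.+1%:R * 3%:R ^+ c.+2 *
      (n%:R ^+ c / m%:R ^+ c.+2 + 2%:R ^+ c.+2 / n%:R)).
Proof.
case: n => [//|N] N1 m1; rewrite prob_meets.
set n := N.+1; have nR : 0 < n%:R :> R by rewrite ltr0n.
have mR : 0 < m%:R :> R by rewrite ltr0n; lia.
(* As m may exceed N, the window [2h] is chosen inside both [m] and [N]; missing a vertex is
   monotone in the window. *)
pose h := (minn m N)./2.
have [h0 hN hm] : [/\ (0 < h)%N, (h.*2 <= N)%N & (h.*2 <= m)%N].
  by rewrite /h; split; lia.
have hR : 0 < h%:R :> R by rewrite ltr0n.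
have card0 := @card_tgt_gt0 c.+1 N.
have -> : 1 - mean (@tgt c.+1 N) (fun f => (missed m f)%:R) =
    mean (@tgt c.+1 N) (fun f => (~~ missed m f)%:R) :> R.
  rewrite -{1}(mean_cst 1 card0) -[- _]mulN1r -meanZ -meanD.
  by apply: eq_mean => f _; case: (missed _ _) => /=; ring.
apply: (@le_trans _ _ (mean (@tgt c.+1 N) (fun f => (~~ missed h.*2 f)%:R))).
  apply: le_mean => f _; rewrite ler_nat.
  case: (boolP (missed h.*2 f)) => [mf|_]; last by rewrite leq_b1.
  by rewrite (missed_mono hm mf).
apply: (le_trans (@present_le R c.+1 N h h0 hN)).
rewrite [expR 1 * (_ / _)]mulrA -[leLHS]mulrA.
apply: ler_wpM2l; first by rewrite mulr_ge0 ?expR_ge0 ?exprn_ge0.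
set a : R := m%:R^-1; set b : R := 2%:R / n%:R; set v : R := h%:R^-1.
have a0 : 0 <= a by rewrite invr_ge0 ltW.
have b0 : 0 <= b by rewrite divr_ge0 // ltW.
have v0 : 0 <= v by rewrite invr_ge0 ltW.
(* Half of an integer >= 2, rounded down, is at least a third of it; and N/3 >= n/6. *)
have vab : v <= 3%:R * a \/ v <= 3%:R * b.
  have [mN|Nm] := leqP m N; [left|right].
    by rewrite /v /a ler_pdivlMr // ler_pdivrMl // -natrM ler_nat /h; lia.
  rewrite /v /b mulrA ler_pdivlMr // ler_pdivrMl // -!natrM ler_nat /h /n.
  by lia.
have v1 : v <= 3%:R * (a + b).
  by case: vab => /le_trans; apply; rewrite ler_wpM2l ?lerDl ?lerDr.
have v2 : v ^+ c.+2 <= 3%:R ^+ c.+2 * (a ^+ c.+2 + b ^+ c.+2).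
  have lev x : 0 <= x -> v <= 3%:R * x -> v ^+ c.+2 <= 3%:R ^+ c.+2 * x ^+ c.+2.
    by move=> x0 vx; rewrite -exprMn lerXn2r ?nnegrE ?mulr_ge0.
  case: vab => [/(lev _ a0)|/(lev _ b0)] /le_trans; apply;
    by rewrite ler_wpM2l ?exprn_ge0 // ?lerDl ?lerDr exprn_ge0.
(* Factor the difference of powers: n - N = 1, and each of the c+1 summands is at most n^c. *)
have dn : n%:R ^+ c.+1 - N%:R ^+ c.+1 <= c.+1%:R * n%:R ^+ c :> R.
  rewrite subrXX -[n%:R - _]natrB // subSnn mul1r.
  have -> : c.+1%:R * n%:R ^+ c = \sum_(i < c.+1) n%:R ^+ c :> R.
    by rewrite sumr_const card_ord mulr_natl.
  apply: ler_sum => i _; rewrite -[c in leRHS](subnK (ltn_ord i : i <= c)%N).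
  rewrite exprD ler_wpM2l ?exprn_ge0 //.
  by apply: lerXn2r; rewrite ?nnegrE // ler_nat.
rewrite mulrDr mulr1; apply: lerD => //.
have -> : n%:R ^+ c / m%:R ^+ c.+2 = n%:R ^+ c * a ^+ c.+2 by rewrite exprVn.
apply: (@le_trans _ _ (c.+1%:R * n%:R ^+ c * v ^+ c.+2)).
  rewrite [v ^+ _]exprS [leRHS]mulrCA; apply: ler_wpM2l => //.
  apply: ler_pM => //.
    by rewrite subr_ge0 lerXn2r ?nnegrE // ler_nat.
  rewrite exprVn lef_pV2 ?posrE ?exprn_gt0 ?ltr0n //; last by lia.
  by apply: lerXn2r; rewrite ?nnegrE // ler_nat; lia.
rewrite -[leLHS]mulrA -[leRHS]mulrA; apply: ler_wpM2l => //.
apply: (@le_trans _ _ (n%:R ^+ c * (3%:R ^+ c.+2 * (a ^+ c.+2 + b ^+ c.+2)))).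
  by apply: ler_wpM2l => //; exact: exprn_ge0.
rewrite [leLHS]mulrCA; apply: ler_wpM2l; first exact: exprn_ge0.
rewrite mulrDr lerD2l /b expr_div_n [leLHS]mulrCA; apply: ler_wpM2l => //.
rewrite !exprS !invfM mulrCA [n%:R ^+ c * _]mulrCA divff; last first.
  by rewrite expf_neq0 // lt0r_neq0.
rewrite mulr1 -[leRHS]mulr1; apply: ler_wpM2l; first by rewrite invr_ge0 ltW.
by rewrite invf_le1 // ler1n.
Qed.

End Estimates.

(** * The threshold *)

Local Open Scope classical_set_scope.

Lemma dag_prob_ge0 (R : realType) d n (E : pred (dag d n)) :
  0 <= dag_prob R E.
Proof.
apply: sumr_ge0 => G _; apply: prodr_ge0 => i _; apply: prodr_ge0 => k _.
by rewrite invr_ge0.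
Qed.

Lemma dag_prob_le1 (R : realType) d n (E : pred (dag d n)) : (0 < n)%N ->
  dag_prob R E <= 1.
Proof.
case: n E => // N E _.
have -> : dag_prob R E = dag_prob R [pred G | (E \o @of_cfg d N) (to_cfg G)].
  by apply: eq_bigl => G; rewrite inE /= to_cfgK.
rewrite dag_prob_mean -[leRHS](mean_cst 1 (@card_tgt_gt0 d N)).
by apply: le_mean => f _; rewrite lern1 leq_b1.
Qed.

(** For d = c+1 the exponent is c/(c+2), so m^(c+2)/n^c is the (c+2)-th power of m/g(n). *)
Lemma exponent_expr (R : realType) (c n : nat) :
  (n%:R `^ ((c.+1%:R - 1) / (c.+1%:R + 1))) ^+ c.+2 = n%:R ^+ c :> R.
Proof.
rewrite -powR_mulrn ?powR_ge0 // -powRrM natr1 mulfVK ?pnatr_eq0 //.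
by rewrite -(natr1 c) addrK powR_mulrn.
Qed.

Theorem theorem8 (R : realType) (d : nat) (hd : (2 <= d)%N) :
  threshold (fun n : nat => n%:R `^ ((d%:R - 1) / (d%:R + 1)) : R)
    (fun (n : nat) (G : dag d n) => ~: descendants G).
Proof.
case: d hd => // c c0 m p.
pose g n : R := n%:R `^ ((c.+1%:R - 1) / (c.+1%:R + 1)).
have g_gt0 n : (0 < n)%N -> 0 < g n by move=> n0; rewrite powR_gt0 ?ltr0n.
have gE n : g n ^+ c.+2 = n%:R ^+ c by exact: exponent_expr.
have g_ge1 n : (0 < n)%N -> 1 <= g n.
  move=> n0; rewrite -(@expr_ge1 _ c.+2) ?gE ?exprn_ege1 ?ler1n //.
  by rewrite ltW ?g_gt0.
have inv_cvg : (n%:R^-1 : R) @[n --> \oo] --> (0 : R).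
  apply/gtr0_cvgV0; last exact: cvgr_idn.
  by near=> n; rewrite ltr0n; near: n; exact: nbhs_infty_gt.
have pow0 (u : nat -> R) : u n @[n --> \oo] --> (0 : R) ->
    u n ^+ c.+2 @[n --> \oo] --> (0 : R).
  move=> u0; rewrite -[X in _ --> X](expr0n R c.+2).
  exact: (cvg_comp _ _ u0 (@exprn_continuous R c.+2 0)).
split=> [m_small|m_large].
  pose x n : R := (m n)%:R / g n.
  have x0 : x n @[n --> \oo] --> (0 : R).
    apply/cvgr0Pnorm_le => e e0.
    have /eqoP/(_ e e0) := m_small; apply: filterS2 (nbhs_infty_gt 0) => n n0.
    by rewrite /x normrM normfV ler_pdivrMr // normr_gt0 gt_eqF ?g_gt0.
  apply: (@squeeze_cvgr _ _ _ _ (fun=> 0)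
    (fun n => 2%:R ^+ c * (x n ^+ c.+2 + 2%:R ^+ c.+2 * n%:R^-1))).
  - near=> n; rewrite dag_prob_ge0 /= (le_trans (prob_meets_le _ c0 _)) //.
      by near: n; exact: nbhs_infty_gt.
    by rewrite /x expr_div_n gE.
  - exact: cvg_cst.
  rewrite -[X in _ --> X](mulr0 (2%:R ^+ c)); apply: cvgMr.
  rewrite -[X in _ --> X](addr0 0); apply: cvgD; first exact: pow0.
  rewrite -[X in _ --> X](mulr0 (2%:R ^+ c.+2)); exact: cvgMr.
pose x n : R := g n / (m n)%:R.
(* Eventually m >= 2 g(n), and g(n) >= 1. *)
have m_gt1 : \forall n \near \oo, (1 < m n)%N.
  have /cvgryPge/(_ 2) := m_large; apply: filterS2 (nbhs_infty_gt 0) => n n0.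
  rewrite ler_pdivlMr ?g_gt0 // => gm; rewrite -(ltr_nat R).
  by apply: lt_le_trans gm; rewrite -/(g n); have := g_ge1 n n0; lra.
have x0 : x n @[n --> \oo] --> (0 : R).
  have -> : x = (fun n => ((m n)%:R / g n)^-1).
    by apply/funext => n; rewrite /x /= invf_div.
  apply/gtr0_cvgV0; last exact: m_large.
  near=> n; have n0 : (0 < n)%N by near: n; exact: nbhs_infty_gt.
  have m1 : (1 < m n)%N by near: n.
  by rewrite divr_gt0 ?g_gt0 // ltr0n ltnW.
apply: (@squeeze_cvgr _ _ _ _ (fun n => 1 - expR 1 * 2%:R ^+ c.+1 *
    (3%:R * (x n + 2%:R * n%:R^-1) + c.+1%:R * 3%:R ^+ c.+2 *
      (x n ^+ c.+2 + 2%:R ^+ c.+2 * n%:R^-1))) (fun=> 1)).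
- near=> n.
  have n2 : (2 < n)%N by near: n; exact: nbhs_infty_gt.
  have m1 : (1 < m n)%N by near: n.
  have n0 : (0 < n)%N by lia.
  rewrite dag_prob_le1 // andbT lerBlDl -lerBlDr.
  apply: (le_trans (prob_meets_ge c n2 m1)).
  apply: ler_wpM2l; first by rewrite mulr_ge0 ?expR_ge0 ?exprn_ge0.
  apply: lerD; last by rewrite /x expr_div_n gE.
  (* The term 1/m is at most g(n)/m because g(n) >= 1. *)
  apply: ler_wpM2l => //; rewrite lerD2r /x -[leLHS]mul1r.
  by apply: ler_wpM2r; rewrite ?invr_ge0 ?g_ge1.
- rewrite -[X in _ --> X]subr0; apply: cvgB; first exact: cvg_cst.
  rewrite -[X in _ --> X](mulr0 (expR 1 * 2%:R ^+ c.+1)); apply: cvgMr.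
  rewrite -[X in _ --> X](addr0 0); apply: cvgD.
    rewrite -[X in _ --> X](mulr0 3%:R); apply: cvgMr.
    rewrite -[X in _ --> X](addr0 0); apply: cvgD => //.
    by rewrite -[X in _ --> X](mulr0 2%:R); apply: cvgMr.
  rewrite -[X in _ --> X](mulr0 (c.+1%:R * 3%:R ^+ c.+2)); apply: cvgMr.
  rewrite -[X in _ --> X](addr0 0); apply: cvgD; first exact: pow0.
  by rewrite -[X in _ --> X](mulr0 (2%:R ^+ c.+2)); apply: cvgMr.
exact: cvg_cst.
Unshelve. all: by end_near.
Qed.
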